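(* The Minkowski sum $M_1+M_2$ of the two Meissner bodies of constant width $1$ constructed over the regular tetrahedron with vertices $\frac a2,\frac b2,\frac c2,\frac d2$ is not equal to Robert's body $\mathcal{R}$ of constant width $2$ constructed over the regular tetrahedron $abcd$ of edge length $2$.
   Context: For points $p,q$, $pq$ denotes both the segment and its length. Meissner bodies. Let $\Delta$ be a regular tetrahedron of edge length $\ell$ and $T_\Delta$ its Reuleaux tetrahedron, i.e. the intersection of the four closed balls of radius $\ell$ centered at the vertices of $\Delta$. For an edge $pq$ of $\Delta$ with opposite edge $rs$, let $W_{pq}$ be the wedge with edge the line $pq$ vertically opposite to the dihedral angle of $\Delta$ at $pq$ (bounded by the half-planes of the planes $pqr$ and $pqs$ that are bounded by the line $pq$ and do not contain $r$, respectively $s$), and let $S_{pq}$ be the solid of revolution obtained by rotating about the line $pq$ the circular segment bounded by $pq$ and the minor arc of radius $\ell$ from $p$ to $q$. Rounding the edge $pq$ of $T_\Delta$ means removing $W_{pq}\setminus S_{pq}$ from $T_\Delta$. The two Meissner bodies over $\Delta$ (of constant width $\ell$) are obtained from $T_\Delta$ by rounding three edges: in one body the three edges at a common vertex, in the other the three edges of a common face. Here $M_1,M_2$ are these two bodies with $\ell=1$, with complementary sets of rounded edges (the three edges at a vertex for one, the three edges of the face opposite to that vertex for the other). Confocal parabolas: two parabolas which in suitable coordinates are $z=\frac{x^2}{4\alpha}-\frac{\alpha}{2}$, $y=0$, and $z=-\frac{y^2}{4\alpha}+\frac{\alpha}{2}$, $x=0$ ($\alpha>0$). Parabolic pea pod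 device $\Sigma$. It is given by a plane $H$, a line $L\subset H$ (the axis), a circle in $H$ with center $c\in L$ and radius $r$ (the principal circle), and a chord $I$ of the circle perpendicular to $L$ (the longitudinal beam). The pea disks are the disks of $H$ inside the principal circle, tangent to it and to $I$, lying in the half plane of $H$ determined by $I$ opposite to $c$ (the endpoints of $I$ count as degenerate disks of radius $0$). Their centers lie on a parabola with focus $c$, the pea string; $E(\Sigma)$ is the closed sub-arc of it formed by these centers. For $x\in E(\Sigma)$, $R(x)$ is the radius of the pea disk centered at $x$. The bulb is the 3-dimensional ball with the same center and radius as the pea disk centered on $L$. Two such devices are convex confocal if they share the axis $L$, their planes are orthogonal, their pea strings are confocal parabolas, and the center of the principal circle of each one is the center of the bulb of the other. Robert's body $\mathcal{R}$. Let $abcd$ be a regular tetrahedron of edge length $2$. For each pair of opposite edges $pq$, $rs$ take the (unique) pair of convex confocal parabolic pea pod devices $\Sigma_{pq},\Sigma_{rs}$ with longitudinal beams $pq$ and $rs$. For $x\in E(\Sigma_{pq})$, $y\in E(\Sigma_{rs})$, let $\phi_{pq}(x,y)$ be the point of the line through $x$ and $y$ at distance $R(x)$ from $x$ with $x$ between $\phi_{pq}(x,y)$ and $y$. The wedge-pod surface of $pq$ is $\{\phi_{pq}(x,y): x\in E(\Sigma_{pq}),y\in E(\Sigma_{rs})\}$; put $\gamma_{r,pq}=\{\phi_{pq}(x,r):x\in E(\Sigma_{pq})\}$, a curve on the sphere of radius $2$ centered at $r$ joining $p$ to $q$ (and likewise $\gamma_{s,pq}$). Let $T$ be the intersection of the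 four closed balls of radius $2$ centered at $a,b,c,d$. For each vertex $r$ with opposite face $pqs$, the spherical cap of $r$ is the region of the sphere of radius $2$ centered at $r$ bounded by the simple closed curve $\gamma_{r,pq}\cup\gamma_{r,qs}\cup\gamma_{r,sp}$ and contained in the boundary of $T$. The union of the six wedge-pod surfaces and the four caps is the boundary of a body of constant width $2$, which is Robert's body $\mathcal{R}$. *)

(* Defs.v *)
From HB Require Import structures.
From mathcomp Require Import all_boot all_order all_algebra.
From mathcomp Require Import all_classical all_reals all_analysis.

Set Implicit Arguments.
Unset Strict Implicit.
Unset Printing Implicit Defensive.

Import Order.TTheory GRing.Theory Num.Theory.
Import numFieldNormedType.Exports.

Local Open Scope classical_set_scope.
Local Open Scope ring_scope.

Section Euclidean.
Context {R : realType}.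
Local Notation pt := 'rV[R]_3.
Implicit Types (x y p q r s o u n f : pt) (A B K H L P : set pt).

(* The norm that MathComp-Analysis puts on matrices is the sup norm, hence the
   Euclidean norm below. The topology on [pt] is the usual one in both cases. *)
Definition dot u n : R := \sum_i u 0 i * n 0 i.
Definition enorm u : R := Num.sqrt (dot u u).
Definition dist x y : R := enorm (x - y).

Definition eball o (l : R) : set pt := [set x | dist x o <= l].
Definition esphere o (l : R) : set pt := [set x | dist x o = l].
Definition segment p q : set pt :=
  [set x | exists t : R, 0 <= t <= 1 /\ x = p + t *: (q - p)].
Definition line o u : set pt := [set x | exists t : R, x = o + t *: u].
Definition plane o n : set pt := [set x | dot (x - o) n = 0].

(* The half-plane of the plane p q o bounded by the line pq, not containing o. *)
Definition opposite_halfplane p q o : set pt :=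
  [set x | exists a b : R, 0 <= b /\ x = p + a *: (q - p) - b *: (o - p)].

Definition boundary A : set pt := closure A `\` interior A.
Definition minkowski_sum A B : set pt := [set x + y | x in A & y in B].

Definition support_fun K u : R := sup [set dot x u | x in K].
Definition body K : Prop :=
  [/\ compact K, convex_set (K : set (convex_lmodType pt)) & interior K !=set0].
Definition constant_width (w : R) K : Prop :=
  body K /\ forall u, enorm u = 1 -> support_fun K u + support_fun K (- u) = w.

Definition regular_tetrahedron (l : R) (v : 'I_4 -> pt) : Prop :=
  forall i j, i != j -> dist (v i) (v j) = l.

Definition reuleaux (l : R) (v : 'I_4 -> pt) : set pt :=
  [set x | forall i, eball (v i) l x].

(* W_pq, where rs is the edge opposite to pq. *)
Definition opposite_wedge p q r s : set pt :=
  [set x | exists a b c : R, [/\ 0 <= b, 0 <= c &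
     x = p + a *: (q - p) - b *: (r - p) - c *: (s - p)]].

(* For dist o p = dist o q = l: the region bounded by the chord pq and the
   minor arc of radius l centered at o. *)
Definition circular_segment (l : R) p q o : set pt :=
  opposite_halfplane p q o `&` eball o l.

Definition rotation_about p q (Q : 'M[R]_3) : Prop :=
  [/\ Q *m Q^T = 1%:M, \det Q = 1 & (q - p) *m Q = q - p].

(* S_pq: as dist r p = dist r q = l, the vertex r can serve as the center of
   the arc of the rotated circular segment. *)
Definition rounding_solid (l : R) p q r : set pt :=
  [set x | exists (Q : 'M[R]_3) y, [/\ rotation_about p q Q,
     circular_segment l p q r y & x = p + (y - p) *m Q]].

(* The Reuleaux tetrahedron with the edges {i, j} such that [edges i j]
   rounded; [edges] is meant to be symmetric. *)
Definition rounded (l : R) (v : 'I_4 -> pt) (edges : rel 'I_4) : set pt :=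
  [set x | reuleaux l v x /\
     forall i j k m : 'I_4, uniq [:: i; j; k; m] -> edges i j ->
       ~ (opposite_wedge (v i) (v j) (v k) (v m)
            `\` rounding_solid l (v i) (v j) (v k)) x].

Definition meissner_vertex (l : R) (v : 'I_4 -> pt) (k : 'I_4) : set pt :=
  rounded l v (fun i j => (i == k) || (j == k)).
Definition meissner_face (l : R) (v : 'I_4 -> pt) (k : 'I_4) : set pt :=
  rounded l v (fun i j => (i != k) && (j != k)).

Definition orthonormal3 e1 e2 e3 : Prop :=
  [/\ enorm e1 = 1, enorm e2 = 1 & enorm e3 = 1] /\
  [/\ dot e1 e2 = 0, dot e1 e3 = 0 & dot e2 e3 = 0].

Definition parabola_with_focus f P : Prop :=
  exists (o e1 e2 e3 : pt) (alpha : R),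
    [/\ 0 < alpha, orthonormal3 e1 e2 e3, f = o + alpha *: e3 &
      P = [set x | exists t : R, x = o + t *: e1 + (t ^+ 2 / (4 * alpha)) *: e3]].

Definition confocal_parabolas P P' : Prop :=
  exists (o e1 e2 e3 : pt) (alpha : R),
    [/\ 0 < alpha, orthonormal3 e1 e2 e3,
      P = [set x | exists t : R,
             x = o + t *: e1 + (t ^+ 2 / (4 * alpha) - alpha / 2) *: e3] &
      P' = [set x | exists t : R,
             x = o + t *: e2 + (- (t ^+ 2 / (4 * alpha)) + alpha / 2) *: e3]].

(* The longitudinal beam is [segment beam0 beam1]. It avoids the center, as
   otherwise "the half-plane opposite to the center" would be meaningless. *)
Record pea_pod := PeaPod {
  pod_plane : set pt;
  pod_axis : set pt;
  pod_center : pt;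
  pod_radius : R;
  beam0 : pt;
  beam1 : pt;
  _ : exists o n, n != 0 /\ pod_plane = plane o n;
  _ : exists o u, [/\ u != 0, pod_axis = line o u & dot u (beam1 - beam0) = 0];
  _ : pod_axis `<=` pod_plane;
  _ : pod_axis pod_center;
  _ : pod_plane beam0 /\ pod_plane beam1;
  _ : dist beam0 pod_center = pod_radius /\ dist beam1 pod_center = pod_radius;
  _ : beam0 != beam1;
  _ : ~ segment beam0 beam1 pod_center
}.

Implicit Types S : pea_pod.

(* The disk of center x and radius rho: internally tangent to the principal
   circle, tangent to the beam (at t), on the side of the beam away from the
   center. For rho = 0 this leaves exactly the endpoints of the beam. *)
Definition pea_disk S x (rho : R) : Prop :=
  [/\ 0 <= rho,
      dist x (pod_center S) = pod_radius S - rho,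
      (exists t, [/\ segment (beam0 S) (beam1 S) t, dist x t = rho &
                     dot (x - t) (beam1 S - beam0 S) = 0]) &
      opposite_halfplane (beam0 S) (beam1 S) (pod_center S) x].

Definition pea_arc S : set pt := [set x | exists rho, pea_disk S x rho].

Definition pea_string S P : Prop :=
  parabola_with_focus (pod_center S) P /\ pea_arc S `<=` P.

Definition bulb_center S : set pt := pod_axis S `&` pea_arc S.

Definition orthogonal_planes H H' : Prop :=
  exists (o n o' n' : pt), [/\ n != 0, n' != 0, H = plane o n, H' = plane o' n' &
    dot n n' = 0].

Definition convex_confocal S S' : Prop :=
  [/\ pod_axis S = pod_axis S',
      orthogonal_planes (pod_plane S) (pod_plane S'),
      (exists P P', [/\ pea_string S P, pea_string S' P' &
                        confocal_parabolas P P']),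
      bulb_center S' (pod_center S) &
      bulb_center S (pod_center S')].

(* The pair of devices attached to the opposite edges pq, rs. *)
Definition edge_devices p q r s S S' : Prop :=
  [/\ beam0 S = p /\ beam1 S = q, beam0 S' = r /\ beam1 S' = s &
      convex_confocal S S'].

(* The point at distance rho from x on the line xy, x being between it and y. *)
Definition pea_phi x (rho : R) y : pt := x + (rho / dist x y) *: (x - y).

Definition wedge_pod p q r s : set pt :=
  [set z | exists S S' x rho y, [/\ edge_devices p q r s S S', pea_disk S x rho,
     pea_arc S' y & z = pea_phi x rho y]].

(* gamma_{r,pq} *)
Definition gamma_curve p q r s : set pt :=
  [set z | exists S S' x rho, [/\ edge_devices p q r s S S', pea_disk S x rho &
     z = pea_phi x rho r]].

(* The three gamma curves on the sphere centered at v k. *)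
Definition cap_curve (v : 'I_4 -> pt) (k : 'I_4) : set pt :=
  [set z | exists i j m : 'I_4, uniq [:: i; j; k; m] /\
     gamma_curve (v i) (v j) (v k) (v m) z].

(* [cap_curve] together with the component of its complement in the sphere
   that is contained in the boundary of the Reuleaux tetrahedron. *)
Definition spherical_cap (v : 'I_4 -> pt) (k : 'I_4) : set pt :=
  let D := esphere (v k) 2 `\` cap_curve v k in
  cap_curve v k `|`
  [set z | D z /\ connected_component D z `<=` boundary (reuleaux 2 v)].

Definition robert_surface (v : 'I_4 -> pt) : set pt :=
  [set z | (exists i j k m : 'I_4, uniq [:: i; j; k; m] /\
              wedge_pod (v i) (v j) (v k) (v m) z) \/
           (exists k : 'I_4, spherical_cap v k z)].

(* A convex body is determined by its boundary, so at most one K qualifies. *)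
Definition robert_body (v : 'I_4 -> pt) K : Prop :=
  constant_width 2 K /\ boundary K = robert_surface v.

End Euclidean.

(* Main.v *)
Require Import Defs.
From mathcomp Require Import all_boot all_order all_algebra.
From mathcomp Require Import all_classical all_reals all_analysis.
From mathcomp Require Import ring lra.

(* Name the vertices i, j, k, m. Robert's body contains the point z of its
   wedge-pod surface of the edge km lying on the line through the vertex of the
   pea string of km and the point v i, at distance 2 from v i. The pea string
   bulges out of the tetrahedron, so the direction from z to v i leaves the
   normal cone of M1 + M2 at v i. Concretely M1, which rounds the edges at k,
   keeps the edge ij sharp; replacing v i / 2 by a point w1 of M1 slightly
   further along that edge yields w = v i / 2 + w1 in M1 + M2 at distance more
   than 2 from z, whereas a body of constant width 2 has diameter at most 2.

   Coordinates: with h = 1 / sqrt 2, the vertices are O +- e1 - h e3 (i, j) and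
   O +- e2 + h e3 (k, m) for an orthonormal frame e1, e2, e3. *)

Set Implicit Arguments.
Unset Strict Implicit.
Unset Printing Implicit Defensive.

Import Order.TTheory GRing.Theory Num.Theory.
Import numFieldNormedType.Exports.

Local Open Scope classical_set_scope.
Local Open Scope ring_scope.

Section Euclidean.
Context {R : realType}.
Local Notation E3 := 'rV[R]_3.
Implicit Types (x y u n : E3) (a r X Y Z : R).

(** * Inner product, Euclidean norm and the diameter of bodies of constant width *)

Lemma dotC u n : dot u n = dot n u.
Proof. by apply: eq_bigr => i _; rewrite mulrC. Qed.

Lemma dotDl x y n : dot (x + y) n = dot x n + dot y n.
Proof. by rewrite -big_split; apply: eq_bigr => i _; rewrite mxE mulrDl. Qed.

Lemma dotZl a x n : dot (a *: x) n = a * dot x n.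
Proof. by rewrite mulr_sumr; apply: eq_bigr => i _; rewrite mxE mulrA. Qed.

Lemma dotNl x n : dot (- x) n = - dot x n.
Proof. by rewrite -scaleN1r dotZl mulN1r. Qed.

Lemma dotDr n x y : dot n (x + y) = dot n x + dot n y.
Proof. by rewrite !(dotC n) dotDl. Qed.

Lemma dotZr a n x : dot n (a *: x) = a * dot n x.
Proof. by rewrite !(dotC n) dotZl. Qed.

Lemma dotNr n x : dot n (- x) = - dot n x.
Proof. by rewrite !(dotC n) dotNl. Qed.

Definition dotE := (dotDl, dotDr, dotNl, dotNr, dotZl, dotZr).

Lemma dot_ge0 u : 0 <= dot u u.
Proof. by apply: sumr_ge0 => i _; rewrite -expr2 sqr_ge0. Qed.

Lemma enorm_sqr u : enorm u ^+ 2 = dot u u.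
Proof. by rewrite sqr_sqrtr // dot_ge0. Qed.

Lemma enorm_eq u r : 0 <= r -> dot u u = r ^+ 2 -> enorm u = r.
Proof. by move=> r0 ur; rewrite /enorm ur sqrtr_sqr ger0_norm. Qed.

Lemma enorm_le u r : 0 <= r -> (enorm u <= r) = (dot u u <= r ^+ 2).
Proof.
by move=> r0; rewrite -enorm_sqr ler_sqr // nnegrE ?sqrtr_ge0.
Qed.

Lemma dot_le1 u n : dot u u <= 1 -> dot n n <= 1 -> dot u n <= 1.
Proof.
move=> u1 n1; have := dot_ge0 (u - n).
rewrite !dotE (dotC n u); lra.
Qed.

Lemma enorm1_neq0 u : enorm u = 1 -> u != 0.
Proof.
move=> u1; apply/eqP => u0; have := enorm_sqr u.
by rewrite u1 u0 -(scale0r 0) dotZl mul0r expr1n => /eqP; rewrite oner_eq0.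
Qed.

(* Boundedness is assumed because [sup] is 0 on an unbounded set. *)
Lemma constant_width_diam w (K : set 'rV[R]_3) x y :
  (forall u, enorm u = 1 -> has_ubound [set dot x u | x in K]) ->
  constant_width w K -> K x -> K y -> 0 < w -> dist x y <= w.
Proof.
move=> bK [_ wK] Kx Ky w0.
have [->|] := eqVneq (dist x y) 0; first exact: ltW.
move=> xy0; have xyp : 0 < dist x y by rewrite lt_neqAle eq_sym xy0 sqrtr_ge0.
pose u := (dist x y)^-1 *: (x - y).
have un1 (e : R) : e ^+ 2 = 1 -> enorm (e *: u) = 1.
  move=> e1; apply: enorm_eq => //.
  rewrite /u !dotZl !dotZr -enorm_sqr -/(dist x y).
  by rewrite expr1n -e1; field.
have u1 : enorm u = 1 by rewrite -[u]scale1r un1 ?expr1n.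
have Nu1 : enorm (- u) = 1 by rewrite -scaleN1r un1 ?sqrrN ?expr1n.
rewrite -(wK u u1).
(* The two terms are bounded by the support values in directions [u] and [- u], which add up to the
   width. *)
have -> : dist x y = dot x u + dot y (- u).
  rewrite dotNr -dotNl -dotDl /u dotZr -enorm_sqr -/(dist x y).
  by field.
by apply: lerD; (apply: sup_upper_bound; last by [exists x|exists y]);
  split; [exists (dot x u); exists x|exact: bK
         |exists (dot y (- u)); exists y|exact: bK].
Qed.

Lemma closed_boundary_sub (K : set 'rV[R]_3) : closed K -> boundary K `<=` K.
Proof. by move=> cK x [] /cK. Qed.

(** * Coordinates in an orthonormal frame *)

Definition vec (e1 e2 e3 : E3) X Y Z : E3 := X *: e1 + Y *: e2 + Z *: e3.
Definition pnt (O e1 e2 e3 : E3) X Y Z : E3 := O + vec e1 e2 e3 X Y Z.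

Lemma pntB (O e1 e2 e3 : E3) X Y Z X' Y' Z' :
  pnt O e1 e2 e3 X Y Z - pnt O e1 e2 e3 X' Y' Z' =
  vec e1 e2 e3 (X - X') (Y - Y') (Z - Z').
Proof. by apply/rowP => i; rewrite !mxE; ring. Qed.

Lemma vecN3 (e1 e2 e3 : E3) X Y Z :
  vec e2 e1 (- e3) Y X Z = vec e1 e2 e3 X Y (- Z).
Proof. by apply/rowP => i; rewrite !mxE; ring. Qed.

Lemma dot_vec (e1 e2 e3 : E3) X Y Z X' Y' Z' : orthonormal3 e1 e2 e3 ->
  dot (vec e1 e2 e3 X Y Z) (vec e1 e2 e3 X' Y' Z') = X * X' + Y * Y' + Z * Z'.
Proof.
move=> [[n1 n2 n3] [d12 d13 d23]]; rewrite !dotE -!enorm_sqr n1 n2 n3.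
rewrite (dotC e2 e1) (dotC e3 e1) (dotC e3 e2) d12 d13 d23; ring.
Qed.

(** This change of frame exchanges two opposite edges of the tetrahedron, so facts about one device
    transfer to the other. *)
Lemma orthonormal3_swap (e1 e2 e3 : E3) :
  orthonormal3 e1 e2 e3 -> orthonormal3 e2 e1 (- e3).
Proof.
move=> [[n1 n2 n3] [d12 d13 d23]]; rewrite /orthonormal3 !dotNr (dotC e2 e1).
by rewrite d12 d13 d23 oppr0 n1 n2 /enorm dotNl dotNr opprK; split.
Qed.

Lemma dist_pnt (O e1 e2 e3 : E3) X Y Z X' Y' Z' (r : R) :
  orthonormal3 e1 e2 e3 -> 0 <= r ->
  (X - X') ^+ 2 + (Y - Y') ^+ 2 + (Z - Z') ^+ 2 = r ^+ 2 ->
  dist (pnt O e1 e2 e3 X Y Z) (pnt O e1 e2 e3 X' Y' Z') = r.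
Proof.
move=> on r0 E; apply: enorm_eq => //.
by rewrite pntB dot_vec // -!expr2.
Qed.

Lemma distE_pnt (O e1 e2 e3 : E3) X Y Z X' Y' Z' : orthonormal3 e1 e2 e3 ->
  dist (pnt O e1 e2 e3 X Y Z) (pnt O e1 e2 e3 X' Y' Z') ^+ 2 =
  (X - X') ^+ 2 + (Y - Y') ^+ 2 + (Z - Z') ^+ 2.
Proof. by move=> on; rewrite enorm_sqr pntB dot_vec // -!expr2. Qed.

(** * The pea pod devices of two opposite edges *)

(* With [h ^+ 2 = 1 / 2], requiring the parabolas to be confocal with foci
   [(1 + h) / 2] away from [O] and the beam ends to lie on them forces the focal
   length [alpha = 1 + h] and the radius [3 * alpha / 2 - h = (3 + h) / 2]. *)
Definition edge_pod (h : R) (O e1 e2 e3 : E3) (S : pea_pod (R := R)) : Prop :=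
  [/\ pod_plane S = plane O e2, pod_axis S = line O e3,
      pod_center S = pnt O e1 e2 e3 0 0 ((1 + h) / 2) /\
        pod_radius S = (3 + h) / 2,
      beam0 S = pnt O e1 e2 e3 1 0 (- h) &
      beam1 S = pnt O e1 e2 e3 (- 1) 0 (- h)].

Definition pea_parabola (h : R) (O e1 e3 : E3) : set E3 :=
  [set x | exists t : R,
    x = O + t *: e1 + (t ^+ 2 / (4 * (1 + h)) - (1 + h) / 2) *: e3].


Lemma h_bounds (h : R) : 0 < h -> h ^+ 2 = 2^-1 -> 7 / 10 < h < 71 / 100.
Proof. by rewrite expr2 => *; apply/andP; split; nra. Qed.

Lemma edge_pod_exists (h : R) (O e1 e2 e3 : E3) : 0 < h -> h ^+ 2 = 2^-1 ->
  orthonormal3 e1 e2 e3 ->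
  exists S, edge_pod h O e1 e2 e3 S.
Proof.
move=> h_gt0 h2 on; have /andP[h1 h3] := h_bounds h_gt0 h2.
have [[n1 n2 n3] [d12 d13 d23]] := on.
have vE X Y Z : pnt O e1 e2 e3 X Y Z - O = vec e1 e2 e3 X Y Z.
  by apply/rowP => i; rewrite !mxE; ring.
have e2E : e2 = vec e1 e2 e3 0 1 0 by apply/rowP => i; rewrite !mxE; ring.
have e3E : e3 = vec e1 e2 e3 0 0 1 by apply/rowP => i; rewrite !mxE; ring.
have pl X Z : plane O e2 (pnt O e1 e2 e3 X 0 Z).
  by rewrite /plane /= vE {2}e2E dot_vec //; ring.
unshelve eexists (@PeaPod R (plane O e2) (line O e3)
  (pnt O e1 e2 e3 0 0 ((1 + h) / 2)) ((3 + h) / 2)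
  (pnt O e1 e2 e3 1 0 (- h)) (pnt O e1 e2 e3 (- 1) 0 (- h)) _ _ _ _ _ _ _ _);
  last by split.
- by exists O, e2; split=> //; exact: enorm1_neq0.
- exists O, e3; split=> //; first exact: enorm1_neq0.
  by rewrite {1}e3E pntB dot_vec //; ring.
- move=> x [t ->].
  have -> : O + t *: e3 = pnt O e1 e2 e3 0 0 t.
    by apply/rowP => i; rewrite !mxE; ring.
  exact: pl.
- by exists ((1 + h) / 2); apply/rowP => i; rewrite !mxE; ring.
- by split; exact: pl.
- split; apply: dist_pnt => //; lra.
- apply/eqP => /(congr1 (fun x => dot (x - O) (vec e1 e2 e3 1 0 0))).
  by rewrite !vE !dot_vec //; lra.
- move=> [t [t01]] /(congr1 (fun x => dot (x - O) e3)).
  rewrite vE pntB.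
  have -> : pnt O e1 e2 e3 1 0 (- h)
      + t *: vec e1 e2 e3 (-1 - 1) (0 - 0) (- h - - h) - O
    = vec e1 e2 e3 (1 - 2 * t) 0 (- h).
    by apply/rowP => i; rewrite !mxE; ring.
  by rewrite {2 4}e3E !dot_vec //; lra.
Qed.

(** Focus and directrix: [rho] is the distance to the beam, so tangency to the circle equates the
    distance to the center with that to a line parallel to the beam. In coordinates the squares of
    [Z] cancel. *)
Lemma pea_disk_parabola (h : R) (O e1 e2 e3 : E3) S x rho :
  0 < h -> h ^+ 2 = 2^-1 ->
  orthonormal3 e1 e2 e3 ->
  edge_pod h O e1 e2 e3 S -> pea_disk S x rho ->
  pea_parabola h O e1 e3 x.
Proof.
move=> h_gt0 h2 on; have /andP[h1 h3] := h_bounds h_gt0 h2.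
move=> [_ _ [cE rE] b0E b1E] [rho0 xc [t [[s [_ tE]] xt tperp]] [a [b [b0 xE]]]].
rewrite b0E b1E cE in tE tperp xE xc; rewrite rE in xc.
pose X := 1 - 2 * a + b; pose Z := - h - b * ((1 + h) / 2 + h).
have {}xE : x = pnt O e1 e2 e3 X 0 Z.
  by rewrite xE; apply/rowP => i; rewrite !mxE /X /Z; ring.
have {}tE : t = pnt O e1 e2 e3 (1 - 2 * s) 0 (- h).
  by rewrite tE; apply/rowP => i; rewrite !mxE; ring.
have Xs : X = 1 - 2 * s by move: tperp; rewrite xE tE !pntB dot_vec //; lra.
(* The half-plane condition [0 <= b] puts [x] below the beam, which fixes the sign in
   [rho = - h - Z]. *)
have Zh : - h - Z = b * ((1 + h) / 2 + h) by rewrite /Z; ring.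
have rhoE : rho = - h - Z.
  rewrite -xt xE tE Xs; apply: dist_pnt => //; last by ring.
  by rewrite Zh mulr_ge0 //; lra.
have : dist x (pnt O e1 e2 e3 0 0 ((1 + h) / 2)) ^+ 2 =
    ((3 + h) / 2 - rho) ^+ 2 by rewrite xc.
rewrite rhoE xE distE_pnt // => XZ.
have ZE : Z = X ^+ 2 / (4 * (1 + h)) - (1 + h) / 2.
  have -> : X ^+ 2 = 4 * (1 + h) * (Z + (1 + h) / 2) by lra.
  by field; lra.
by exists X; rewrite -ZE; apply/rowP => i; rewrite !mxE; ring.
Qed.

Lemma pea_disk_beam0 (h : R) (O e1 e2 e3 : E3) S :
  0 < h -> h ^+ 2 = 2^-1 ->
  orthonormal3 e1 e2 e3 ->
  edge_pod h O e1 e2 e3 S -> pea_disk S (beam0 S) 0.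
Proof.
move=> h_gt0 h2 on; have /andP[h1 h3] := h_bounds h_gt0 h2.
move=> [_ _ [cE rE] b0E b1E]; rewrite /pea_disk cE rE b0E b1E; split=> //.
- by apply: dist_pnt => //; lra.
- exists (pnt O e1 e2 e3 1 0 (- h)); split.
  + by exists 0; rewrite lexx ler01 scale0r addr0.
  + by apply: dist_pnt => //; ring.
  + by rewrite !pntB dot_vec //; ring.
- by exists 0, 0; rewrite lexx !scale0r addr0 subr0.
Qed.

Lemma pea_disk_vertex (h : R) (O e1 e2 e3 : E3) S :
  0 < h -> h ^+ 2 = 2^-1 ->
  orthonormal3 e1 e2 e3 ->
  edge_pod h O e1 e2 e3 S ->
  pea_disk S (pnt O e1 e2 e3 0 0 (- ((1 + h) / 2))) ((1 - h) / 2).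
Proof.
move=> h_gt0 h2 on; have /andP[h1 h3] := h_bounds h_gt0 h2.
move=> [_ _ [cE rE] b0E b1E]; rewrite /pea_disk cE rE b0E b1E; split=> //.
- lra.
- by apply: dist_pnt => //; first [lra|field].
- exists (pnt O e1 e2 e3 0 0 (- h)); split.
  + exists 2^-1; split; first by lra.
    by apply/rowP => i; rewrite !mxE; field.
  + by apply: dist_pnt => //; first [lra|field].
  + by rewrite !pntB dot_vec //; ring.
(* Solution of [1 - 2 * a + b = 0] and [b * (1 + 3 * h) / 2 = (1 - h) / 2]. *)
- exists ((1 + h) / (1 + 3 * h)), ((1 - h) / (1 + 3 * h)); split.
    by apply: divr_ge0; lra.
  by apply/rowP => i; rewrite !mxE; field; lra.
Qed.

Lemma pea_parabola_focus (h : R) (O e1 e2 e3 : E3) :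
  0 < h -> orthonormal3 e1 e2 e3 ->
 
  parabola_with_focus (pnt O e1 e2 e3 0 0 ((1 + h) / 2)) (pea_parabola h O e1 e3).
Proof.
move=> h_gt0 on.
exists (pnt O e1 e2 e3 0 0 (- ((1 + h) / 2))), e1, e2, e3, (1 + h); split => //.
- by rewrite addr_gt0.
- by apply/rowP => i; rewrite !mxE; field.
- apply/seteqP; split=> x [t ->]; exists t; apply/rowP => i; rewrite !mxE; ring.
Qed.

(** Focus and vertex of each string are symmetric about [O], and the swapped frame reverses [e3];
    hence the center of each device is the vertex of the other's string, its bulb center. *)
Lemma convex_confocal_edge_pods (h : R) (O e1 e2 e3 : E3) S S' :
  0 < h -> h ^+ 2 = 2^-1 -> orthonormal3 e1 e2 e3 ->
  edge_pod h O e2 e1 (- e3) S -> edge_pod h O e1 e2 e3 S' ->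
  convex_confocal S S'.
Proof.
move=> h_gt0 h2 on pS pS'; have on' := orthonormal3_swap on.
have [plS axS [cS rS] b0S b1S] := pS.
have [plS' axS' [cS' rS'] b0S' b1S'] := pS'.
have axE : line O (- e3) = line O e3.
  by apply/seteqP; split=> x [t ->]; exists (- t);
    rewrite ?scalerN scaleNr ?opprK.
have axO t : line O e3 (pnt O e1 e2 e3 0 0 t).
  by exists t; rewrite /pnt /vec !scale0r !add0r.
split.
- by rewrite axS axS'.
- have [[n1 n2 n3] [d12 d13 d23]] := on.
  by exists O, e1, O, e2; split=> //; exact: enorm1_neq0.
- exists (pea_parabola h O e2 (- e3)), (pea_parabola h O e1 e3); split.
  + split; first by rewrite cS; exact: pea_parabola_focus on'.
    by move=> x [rho]; exact: (pea_disk_parabola h_gt0 h2 on' pS).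
  + split; first by rewrite cS'; exact: pea_parabola_focus on.
    by move=> x [rho]; exact: (pea_disk_parabola h_gt0 h2 on pS').
  (* Measured along [- e3], the string of [S] opens upwards and that of [S'] downwards. *)
  + exists O, e2, e1, (- e3), (1 + h); split=> //; first by lra.
    by apply/seteqP; split=> x [t ->]; exists t;
      apply/rowP => i; rewrite !mxE; ring.
- split; rewrite cS /pnt vecN3; first by rewrite axS'; exact: axO.
  by exists ((1 - h) / 2); exact: pea_disk_vertex.
- split; rewrite cS'; first by rewrite axS axE; exact: axO.
  exists ((1 - h) / 2).
  by have := pea_disk_vertex h_gt0 h2 on' pS; rewrite /pnt vecN3 opprK.
Qed.

(** The string's vertex is at distance [(3 + h) / 2] from [P 1 0 (- h)]; adding the pea radius
    [(1 - h) / 2] gives 2. The factor [4 / (3 + h)] stretches the first distance to 2. *)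
Lemma wedge_pod_vertex (h : R) (O e1 e2 e3 : E3) :
  0 < h -> h ^+ 2 = 2^-1 -> orthonormal3 e1 e2 e3 ->
  let P := pnt O e1 e2 e3 in
  wedge_pod (P 0 1 h) (P 0 (- 1) h) (P 1 0 (- h)) (P (- 1) 0 (- h))
    (P (1 - 4 / (3 + h)) 0
       (- h + (1 + 3 * h) / 2 * (4 / (3 + h)))).
Proof.
move=> h_gt0 h2 on P; have on' := orthonormal3_swap on.
have /andP[h1 h3] := h_bounds h_gt0 h2.
have [S pS] := edge_pod_exists O h_gt0 h2 on'.
have [S' pS'] := edge_pod_exists O h_gt0 h2 on.
have [_ _ _ b0S b1S] := pS; have [_ _ _ b0S' b1S'] := pS'.
exists S, S', (P 0 0 ((1 + h) / 2)), ((1 - h) / 2), (P 1 0 (- h)); split.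
- split; last exact: convex_confocal_edge_pods pS pS'.
  + by rewrite b0S b1S /pnt !vecN3 opprK.
  + by [].
- by have := pea_disk_vertex h_gt0 h2 on' pS; rewrite /pnt vecN3 opprK.
- by exists 0; rewrite /P -b0S'; exact: pea_disk_beam0 pS'.
- rewrite /pea_phi (_ : dist _ _ = (3 + h) / 2); last by apply: dist_pnt => //; lra.
  by apply/rowP => i; rewrite !mxE; field; lra.
Qed.

(* The right-hand side is the squared distance of the points w and z of the
   header. *)
Lemma witness_dist_gt (h : R) : 0 < h -> h ^+ 2 = 2^-1 ->
  4 < (97 / 100 - (1 - 4 / (3 + h))) ^+ 2 +
      (- h - 1 / 50 - (- h + (1 + 3 * h) / 2 * (4 / (3 + h)))) ^+ 2.
Proof.
move=> h_gt0 h2; have /andP[h1 h3] := h_bounds h_gt0 h2.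
set q := 4 / (3 + h).
have q0 : 0 < q by apply: divr_gt0; lra.
(* The point z is at distance exactly 2 from [v i]. *)
have E : q ^+ 2 * (1 + ((1 + 3 * h) / 2) ^+ 2) = 4.
  have -> : 1 + ((1 + 3 * h) / 2) ^+ 2 = (3 + h) ^+ 2 / 4 by lra.
  by rewrite /q; field; lra.
(* Half the first-order change of the squared distance from [v i] to w, positive as [h > 2 / 3]; the
   remaining terms are squares. *)
have := mulr_gt0 q0 (_ : 0 < (1 + 3 * h) / 100 - 3 / 100).
nra.
Qed.

(** * A frame adapted to the regular tetrahedron *)

Lemma tetrahedron_frame (v : 'I_4 -> E3) i j k m :
  regular_tetrahedron 2 v -> uniq [:: i; j; k; m] ->
  exists (h : R) (O e1 e2 e3 : E3),
    [/\ 0 < h, h ^+ 2 = 2^-1, orthonormal3 e1 e2 e3,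
        v i = pnt O e1 e2 e3 1 0 (- h) /\ v j = pnt O e1 e2 e3 (- 1) 0 (- h) &
        v k = pnt O e1 e2 e3 0 1 h /\ v m = pnt O e1 e2 e3 0 (- 1) h].
Proof.
move=> tv /and4P[]; rewrite !inE !negb_or => /and3P[ij ik im] /andP[jk jm] km _.
have sq (x y : 'I_4) : x != y -> dot (v x - v y) (v x - v y) = 4.
  by move=> /tv; rewrite -enorm_sqr -/(dist _ _) => ->; rewrite -natrX.
have := sq _ _ ij; have := sq _ _ ik; have := sq _ _ im.
have := sq _ _ jk; have := sq _ _ jm; have := sq _ _ km.
move: (v i) (v j) (v k) (v m) => a b c d; rewrite !dotE.
pose gC := (dotC b a, dotC c a, dotC d a, dotC c b, dotC d b, dotC d c).
rewrite !gC.
move=> cd bd bc ad ac ab.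
pose h : R := Num.sqrt 2^-1.
have h_gt0 : 0 < h by rewrite sqrtr_gt0 invr_gt0.
have h2 : h ^+ 2 = 2^-1 by rewrite sqr_sqrtr // invr_ge0.
(* The centroid, half of each opposite edge, and the vector joining their midpoints, which has
   length [2 * h] and is normalized by [h] since [2 * h ^+ 2 = 1]. *)
exists h, (4^-1 *: (a + b + c + d)), (2^-1 *: (a - b)), (2^-1 *: (c - d)),
  ((h / 2) *: (c + d - a - b)); split=> //.
- split; split.
  + apply: enorm_eq => //; rewrite !dotE ?gC; lra.
  + apply: enorm_eq => //; rewrite !dotE ?gC; lra.
  + apply: enorm_eq => //; rewrite dotZl dotZr mulrA.
    have -> : h / 2 * (h / 2) = 8^-1 by lra.
    rewrite !dotE ?gC.
    lra.
  + rewrite !dotE ?gC.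
    lra.
  + rewrite dotZl dotZr.
    have -> : dot (a - b) (c + d - a - b) = 0.
      rewrite !dotE ?gC.
      lra.
    by rewrite !mulr0.
  + rewrite dotZl dotZr.
    have -> : dot (c - d) (c + d - a - b) = 0.
      rewrite !dotE ?gC.
      lra.
    by rewrite !mulr0.
- have hh : h * (h / 2) = 4^-1 by lra.
  by split; rewrite /pnt /vec [(- h) *: _]scaleNr [h *: _]scalerA hh;
    apply/rowP => x; rewrite !mxE; field.
- have hh : h * (h / 2) = 4^-1 by lra.
  by split; rewrite /pnt /vec [h *: _]scalerA hh;
    apply/rowP => x; rewrite !mxE; field.
Qed.

(** * Points of the Meissner bodies *)

Lemma uniq4_mem (i j k m x : 'I_4) :
  uniq [:: i; j; k; m] -> x \in [:: i; j; k; m].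
Proof.
move=> /card_uniqP u.
have /subset_cardP : #|[:: i; j; k; m]| = #|'I_4| by rewrite card_ord u.
by move=> /(_ (subset_predT _)) ->.
Qed.

Lemma exists_uniq4 (k : 'I_4) : exists i j m, uniq [:: i; j; k; m].
Proof.
exists (lift k 0), (lift k 1), (lift k 2).
rewrite /= !inE !negb_or !(inj_eq lift_inj) !neq_lift /= ![_ == k]eq_sym !neq_lift.
by [].
Qed.

Lemma opposite_wedgeC (p q r s : E3) :
  opposite_wedge p q r s = opposite_wedge p q s r.
Proof.
by apply/seteqP; split=> x [a [b [c [b0 c0 ->]]]]; exists a, c, b; split=> //;
  rewrite addrAC.
Qed.

(** [c + dot x n] is the barycentric coordinate of [x] at [v u]. On the wedge at an edge, the
    coordinates at the two vertices off the edge are nonpositive. *)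
Lemma notin_opposite_wedge (v : 'I_4 -> E3) (c : R) n (u : 'I_4) x i j k m :
  (forall w, c + dot (v w) n = (w == u)%:R) -> 0 < c + dot x n ->
  uniq [:: i; j; k; m] -> u != i -> u != j ->
  ~ opposite_wedge (v i) (v j) (v k) (v m) x.
Proof.
move=> cE x0 un ui uj.
wlog uk : k m un / u = k => [wl|].
  have := uniq4_mem u un; rewrite !inE (negbTE ui) (negbTE uj) /=.
  case/orP => /eqP uE; first exact: wl.
  rewrite opposite_wedgeC; apply: wl => //.
  rewrite -(perm_uniq (_ : perm_eq [:: i; j; k; m] _)) // !perm_cons.
  exact: (permEl (perm_catC [:: k] [:: m])).
move=> [a [b [b' [b0 b'0 xE]]]].
move: un; rewrite /= !inE -uk !negb_or => /and4P[_ _ um _].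
have := cE i; have := cE j; have := cE k; have := cE m.
rewrite -uk eqxx ![_ == u]eq_sym (negbTE ui) (negbTE uj) (negbTE um) /=.
rewrite xE -uk !dotE in x0; move: x0; nra.
Qed.

Lemma distxx (x : E3) : dist x x = 0.
Proof. by apply: enorm_eq => //; rewrite subrr -(scale0r 0) dotZl mul0r expr0n. Qed.

Lemma rounding_solid_vertex l (p q r : E3) : dist p r = l -> dist q r = l ->
  rounding_solid l p q r p /\ rounding_solid l p q r q.
Proof.
move=> pr qr.
have rot1 : rotation_about p q 1%:M.
  by split; rewrite ?trmx1 ?mulmx1 ?det1.
split; [exists 1%:M, p|exists 1%:M, q]; split=> //.
- split; last by rewrite /eball /= pr.
  by exists 0, 0; rewrite !scale0r addr0 subr0.
- by rewrite subrr mul0mx addr0.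
- split; last by rewrite /eball /= qr.
  by exists 1, 0; rewrite scale0r scale1r subr0 addrC subrK.
- by rewrite mulmx1 addrC subrK.
Qed.

(** No rounding removes a vertex: it lies in the rounding solid of each edge ending there, and
    outside the wedges of the other edges, its own barycentric coordinate being 1. *)
Lemma rounded_vertex l (v : 'I_4 -> E3) edges (u : 'I_4) (c : R) n :
  0 <= l -> regular_tetrahedron l v ->
  (forall w, c + dot (v w) n = (w == u)%:R) -> rounded l v edges (v u).
Proof.
move=> l0 tv cE; split=> [w|i j k m un _ [W nS]].
  by rewrite /eball /=; have [->|uw] := eqVneq u w; [rewrite distxx|rewrite tv].
move: (un); rewrite /= !inE !negb_or => /and4P[/and3P[_ ik _] /andP[jk _] _ _].
have [ri rj] := rounding_solid_vertex (tv _ _ ik) (tv _ _ jk).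
have [ui|ui] := eqVneq u i; first by apply: nS; rewrite ui.
have [uj|uj] := eqVneq u j; first by apply: nS; rewrite uj.
by apply: (notin_opposite_wedge cE _ un ui uj W); rewrite cE eqxx.
Qed.

Lemma scale_pnt (a : R) (O e1 e2 e3 : E3) X Y Z :
  a *: pnt O e1 e2 e3 X Y Z = pnt (a *: O) e1 e2 e3 (a * X) (a * Y) (a * Z).
Proof. by apply/rowP => i; rewrite !mxE; ring. Qed.

(** Supplies the boundedness required by [constant_width_diam], from the ball about [v 0] alone. *)
Lemma rounded_bounded (v : 'I_4 -> E3) edges x u : rounded 1 v edges x ->
  enorm u = 1 -> dot x u <= 1 + dot (v 0) u.
Proof.
move=> [/(_ 0)]; rewrite /eball /= /dist enorm_le // expr1n => x1 _ u1.
have : dot (x - v 0) u <= 1 by apply: dot_le1; rewrite // -enorm_sqr u1 expr1n.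
by rewrite dotDl dotNl; lra.
Qed.

(* The point lies just beyond the vertex [v i], near the circular edge [i j]
   that [meissner_vertex] at [k] leaves sharp. *)
Lemma meissner_vertex_edge_point (h : R) (O e1 e2 e3 : E3) (v : 'I_4 -> E3)
    i j k m :
  0 < h -> h ^+ 2 = 2^-1 -> orthonormal3 e1 e2 e3 -> uniq [:: i; j; k; m] ->
  v i = pnt O e1 e2 e3 (1 / 2) 0 (- (h / 2)) ->
  v j = pnt O e1 e2 e3 (- (1 / 2)) 0 (- (h / 2)) ->
  v k = pnt O e1 e2 e3 0 (1 / 2) (h / 2) ->
  v m = pnt O e1 e2 e3 0 (- (1 / 2)) (h / 2) ->
  meissner_vertex 1 v k (pnt O e1 e2 e3 (47 / 100) 0 (- (h / 2) - 1 / 50)) /\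
  exists (c : R) n, forall w, c + dot (v w) n = (w == i)%:R.
Proof.
move=> h_gt0 h2 on un vi vj vk vm; have /andP[h1 h3] := h_bounds h_gt0 h2.
(* For [s = 1] and [s = - 1] these give the barycentric coordinates at [v i] and [v j]. *)
pose n s := vec e1 e2 e3 s 0 (- h); pose c s := 1 / 4 - dot O (n s).
have cE s X Y Z : c s + dot (pnt O e1 e2 e3 X Y Z) (n s) = 1 / 4 + s * X - h * Z.
  by rewrite dotDl /c dot_vec //; ring.
move: (un); rewrite /= !inE !negb_or => /and4P[/and3P[ij ik im] /andP[jk jm] km _].
have ci w : c 1 + dot (v w) (n 1) = (w == i)%:R.
  have := uniq4_mem w un; rewrite !inE => /or4P[] /eqP->.
  - by rewrite eqxx vi cE /=; lra.
  - by rewrite eq_sym (negbTE ij) vj cE /=; lra.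
  - by rewrite eq_sym (negbTE ik) vk cE /=; lra.
  - by rewrite eq_sym (negbTE im) vm cE /=; lra.
have cj w : c (- 1) + dot (v w) (n (- 1)) = (w == j)%:R.
  have := uniq4_mem w un; rewrite !inE => /or4P[] /eqP->.
  - by rewrite (negbTE ij) vi cE /=; lra.
  - by rewrite eqxx vj cE /=; lra.
  - by rewrite eq_sym (negbTE jk) vk cE /=; lra.
  - by rewrite eq_sym (negbTE jm) vm cE /=; lra.
split; last by exists (c 1), (n 1).
split=> [w|i' j' k' m' un' /orP ed [W _]].
  rewrite /eball /= enorm_le // -enorm_sqr -/(dist _ _).
  (* The choice of [47 / 100] and [1 / 50] is tight at [k] and [m], where the squared distance is
     just below 1. *)
  have := uniq4_mem w un; rewrite !inE => /or4P[] /eqP->.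
  - by rewrite vi distE_pnt //; nra.
  - by rewrite vj distE_pnt //; nra.
  - by rewrite vk distE_pnt //; nra.
  - by rewrite vm distE_pnt //; nra.
(* A rounded edge ends at [k], so it misses [i] or [j]; the point has positive barycentric
   coordinates at both. *)
have [/andP[ii' ij']|] := boolP ((i != i') && (i != j')).
  by apply: (notin_opposite_wedge ci _ un' ii' ij' W); rewrite cE; nra.
rewrite negb_and !negbK => iE.
have jj : (j != i') && (j != j').
  case: ed iE => /eqP ->; rewrite ?(negbTE ik) ?orbF /= => /eqP <-.
  - by rewrite jk eq_sym.
  - by rewrite eq_sym ij.
have /andP[ji' jj'] := jj.
by apply: (notin_opposite_wedge cj _ un' ji' jj' W); rewrite cE; nra.
Qed.

End Euclidean.

Theorem theorem5p3 (R : realType) (v : 'I_4 -> 'rV[R]_3) (k : 'I_4)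
    (M1 M2 Rob : set 'rV[R]_3) :
  regular_tetrahedron 2 v ->
  M1 = meissner_vertex 1 (fun i => 2^-1 *: v i) k ->
  M2 = meissner_face 1 (fun i => 2^-1 *: v i) k ->
  robert_body v Rob ->
  minkowski_sum M1 M2 <> Rob.
Proof.
move=> tv M1E M2E [wRob bRob] sumE.
have [i [j [m un]]] := exists_uniq4 k.
have [h [G [e1 [e2 [e3 [h_gt0 h2 on [vi vj] [vk vm]]]]]]] :=
  tetrahedron_frame tv un.
pose v' x := 2^-1 *: v x; pose G' := 2^-1 *: G.
have tv' : regular_tetrahedron 1 v'.
  move=> x y xy; apply: enorm_eq => //.
  by rewrite -scalerBr dotZl dotZr -enorm_sqr -/(dist _ _) tv //; field.
have v'E x X Y Z : v x = pnt G e1 e2 e3 X Y Z ->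
    v' x = pnt G' e1 e2 e3 (2^-1 * X) (2^-1 * Y) (2^-1 * Z).
  by rewrite /v' => ->; rewrite scale_pnt.
have [w1 [c [n cE]]] : meissner_vertex 1 v' k
    (pnt G' e1 e2 e3 (47 / 100) 0 (- (h / 2) - 1 / 50)) /\
    exists (c : R) n, forall w, c + dot (v' w) n = (w == i)%:R.
  by apply: (meissner_vertex_edge_point h_gt0 h2 on un);
    [rewrite (v'E _ _ _ _ vi)|rewrite (v'E _ _ _ _ vj)
    |rewrite (v'E _ _ _ _ vk)|rewrite (v'E _ _ _ _ vm)]; congr pnt; lra.
pose w := pnt G e1 e2 e3 (97 / 100) 0 (- h - 1 / 50).
have Rw : Rob w.
  rewrite -sumE M1E M2E.
  exists (pnt G' e1 e2 e3 (47 / 100) 0 (- (h / 2) - 1 / 50)) => //.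
  exists (v' i); first exact: (rounded_vertex _ _ tv' cE).
  by rewrite (v'E _ _ _ _ vi); apply/rowP => x; rewrite !mxE; field.
pose z := pnt G e1 e2 e3 (1 - 4 / (3 + h)) 0
  (- h + (1 + 3 * h) / 2 * (4 / (3 + h))).
have Rz : Rob z.
  have [[compR _ _] _] := wRob.
  apply: (closed_boundary_sub (compact_closed _ compR)).
    exact: norm_hausdorff.
  (* The pod surface is that of the edge km, with [v i] an end of the opposite beam. *)
  rewrite bRob; left; exists k, m, i, j; split.
    by rewrite -(perm_uniq (permEl (perm_catC [:: i; j] [:: k; m]))).
  by rewrite vi vj vk vm; exact: wedge_pod_vertex.
suff : dist w z <= 2.
  rewrite enorm_le // -enorm_sqr -/(dist _ _) distE_pnt //.
  have := witness_dist_gt h_gt0 h2; lra.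
apply: (constant_width_diam _ wRob) => // u u1.
exists (2 + dot (v' 0) u *+ 2) => _ [x + <-]; rewrite -sumE M1E M2E.
move=> [x1 /rounded_bounded/(_ u1) xb1 [x2 /rounded_bounded/(_ u1) xb2 <-]].
rewrite dotDl; rewrite -/(v' 0) in xb1 xb2; lra.
Qed.
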